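(* Let $(P,\le,{}',0,1)$ be a skew orthomodular poset and $a,b\in P$ with $a\le b$. Then the following holds: (i) $S(a,b)=U(b)$ and $F(a,b)=L(a)$; (ii) $c(a,b)=1$.
   Context: An orthoposet is a bounded poset $(P,\le,{}',0,1)$ with an antitone involution ${}'$ (i.e. $x\le y$ implies $y'\le x'$, and $x''=x$) that is a complementation (i.e. $x\vee x'=1$ and $x\wedge x'=0$ for all $x$). For $A\subseteq P$: $L(A):=\{x\in P\mid x\le y\text{ for all }y\in A\}$, $U(A):=\{x\in P\mid y\le x\text{ for all }y\in A\}$. When several arguments (elements and/or subsets) are listed inside $L$ or $U$, the operator is applied to the union of these sets, elements being read as singletons. Singletons are identified with their unique element (so $c(a,b)=1$ means $c(a,b)=\{1\}$). A skew orthomodular poset is an orthoposet such that for all $x,y\in P$: $x\le y$ implies $U(y)=U\big(x,L(y,x')\big)$ (equivalently, $x\le y$ implies $L(x)=L\big(y,U(x,y')\big)$ for all $x,y\in P$). For $x,y\in P$ define $S(x,y):=U\big(L(x,y),L(x,y'),L(x',y)\big)$, $F(x,y):=L\big(U(x,y),U(x,y'),U(x',y)\big)$, $c(x,y):=U\big(L(x,y),L(x,y'),L(x',y),L(x',y')\big)$. *)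

(* Defs.v *)
From mathcomp Require Import all_boot all_order.
From mathcomp Require Import boolp classical_sets.

Set Implicit Arguments.
Unset Strict Implicit.
Unset Printing Implicit Defensive.

Local Open Scope classical_set_scope.

(* The classical operators L and U on subsets of a poset are [lbound] and
   [ubound]; a list of arguments is read as the union of the listed sets,
   elements being singletons, e.g. L(x, y) is [lbound [set x; y]].
   The order is written with %O because order_scope and classical_set_scope
   both use the infix `|`. *)

Section Orthoposets.
Variables (d : Order.disp_t) (P : tbPOrderType d).
Implicit Types (compl : P -> P) (x y : P).

(* [supremums A m] says that m is the supremum of A, without assuming that
   other subsets have one; likewise for [infimums]. *)
Definition is_orthocomplementation compl : Prop :=
  [/\ forall x y, (x <= y)%O -> (compl y <= compl x)%O,
      forall x, compl (compl x) = x,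
      forall x, supremums [set x; compl x] \top%O &
      forall x, infimums [set x; compl x] \bot%O].

Definition skew_orthomodular compl : Prop :=
  is_orthocomplementation compl /\
  forall x y, (x <= y)%O ->
    ubound [set y] = ubound ([set x] `|` lbound [set y; compl x]).

Definition S_op compl x y : set P :=
  ubound (lbound [set x; y] `|` lbound [set x; compl y]
          `|` lbound [set compl x; y]).

Definition F_op compl x y : set P :=
  lbound (ubound [set x; y] `|` ubound [set x; compl y]
          `|` ubound [set compl x; y]).

Definition c_op compl x y : set P :=
  ubound (lbound [set x; y] `|` lbound [set x; compl y]
          `|` lbound [set compl x; y] `|` lbound [set compl x; compl y]).

End Orthoposets.

(* Main.v *)
Require Import Defs.
From mathcomp Require Import all_boot all_order.
From mathcomp Require Import boolp classical_sets.

(** For a <= b the set L(a,b') is contained in L(b,b') = {0} and L(a,b) = L(a),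
    so S(a,b) collapses to U(a,L(b,a')), which is U(b) by skew orthomodularity
    ([S_op_le]).  The other two claims reduce to this one.  The involution
    exchanges L and U, hence z lies in F(a,b) exactly when z' lies in S(b',a');
    as b' <= a', that set is U(a'), and z' >= a' means z <= a.
    Finally c(a,b) is the intersection of S(a,b) = U(b) with
    U(L(a',b')) = U(b'), and b, b' have no common upper bound but 1. *)

Import Order.TTheory.
Local Open Scope classical_set_scope.

Section BoundsInPosets.
Context {d : Order.disp_t} {P : porderType d}.
Implicit Types (x y z : P) (A B : set P).

Lemma in_lbound2 x y z : lbound [set x; y] z <-> (z <= x)%O /\ (z <= y)%O.
Proof.
split=> [zL|[zx zy] w [->|->] //].
by split; apply: zL; [left|right].
Qed.

Lemma in_ubound2 x y z : ubound [set x; y] z <-> (x <= z)%O /\ (y <= z)%O.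
Proof.
split=> [zU|[xz yz] w [->|->] //].
by split; apply: zU; [left|right].
Qed.

Lemma in_ubound1 x z : ubound [set x] z <-> (x <= z)%O.
Proof. by split=> [|xz w ->//]; apply. Qed.

Lemma in_lbound1 x z : lbound [set x] z <-> (z <= x)%O.
Proof. by split=> [|zx w ->//]; apply. Qed.

Lemma uboundU A B : ubound (A `|` B) = ubound A `&` ubound B.
Proof.
apply/seteqP; split=> z /=; last by move=> [zA zB] w [/zA|/zB].
by move=> zAB; split=> w ?; apply: zAB; [left|right].
Qed.

(** Here L(x,y) = L(x), which has x as its greatest element. *)
Lemma ubound_lbound2_le x y : (x <= y)%O ->
  ubound (lbound [set x; y]) = ubound [set x].
Proof.
move=> xy; apply/seteqP; split=> z zU.
  by apply/in_ubound1; apply: zU; apply/in_lbound2.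
move=> w /in_lbound2[wx _].
by apply: le_trans wx _; apply/in_ubound1.
Qed.

End BoundsInPosets.

Section Orthoposets.
Context {d : Order.disp_t} {P : tbPOrderType d} {compl : P -> P}.
Context (hO : is_orthocomplementation compl).
Implicit Types (x y z : P) (A : set P).

Lemma complK : involutive compl.
Proof. by case: hO. Qed.

Lemma le_compl2 x y : (compl x <= compl y)%O = (y <= x)%O.
Proof.
have [anti _ _ _] := hO.
by apply/idP/idP => /anti //; rewrite !complK.
Qed.

Lemma le_complr x y : (x <= compl y)%O = (y <= compl x)%O.
Proof. by rewrite -{1}(complK x) le_compl2. Qed.

Lemma lbound_compl x : lbound [set x; compl x] = [set \bot%O].
Proof.
have [_ _ _ /(_ x) [xL xmax]] := hO.
apply/seteqP; split=> z /=; last by move=> ->.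
by move=> /xmax; rewrite lex0 => /eqP.
Qed.

Lemma ubound_compl x : ubound [set x; compl x] = [set \top%O].
Proof.
have [_ _ /(_ x) [xU xmin] _] := hO.
apply/seteqP; split=> z /=; last by move=> ->.
by move=> /xmin; rewrite le1x => /eqP.
Qed.

(** Holds because L(x,y') is contained in L(y,y'). *)
Lemma lbound_disjoint x y : (x <= y)%O -> lbound [set x; compl y] = [set \bot%O].
Proof.
move=> xy; apply/seteqP; split=> z /=; last first.
  by move=> ->; apply/in_lbound2; rewrite !le0x.
move=> /in_lbound2[zx zy'].
have : lbound [set y; compl y] z.
  by apply/in_lbound2; split=> //; apply: le_trans xy.
by rewrite lbound_compl.
Qed.

Lemma lbound_preim_compl A :
  lbound A = compl @^-1` ubound (compl @^-1` A).
Proof.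
apply/seteqP; split=> z /= zA w wA.
  by rewrite -(complK w) le_compl2; apply: zA.
by rewrite -le_compl2; apply: zA; rewrite /= complK.
Qed.

Lemma preim_compl_ubound2 x y :
  compl @^-1` ubound [set x; y] = lbound [set compl x; compl y].
Proof.
apply/seteqP; split=> z /= => [/in_ubound2|/in_lbound2] [h1 h2].
  by apply/in_lbound2; rewrite !(le_complr z).
by apply/in_ubound2; rewrite !(le_complr _ z).
Qed.

(** The duality between F and S. Swapping the two arguments is immaterial, S
    being symmetric, but makes the pair on the right increasing when x <= y. *)
Lemma F_op_compl x y :
  F_op compl x y = compl @^-1` S_op compl (compl y) (compl x).
Proof.
rewrite /F_op /S_op lbound_preim_compl !preimage_setU !preim_compl_ubound2.
rewrite !complK; congr (_ @^-1` ubound _).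
by rewrite ![[set _; compl x]]setUC [[set compl y; _]]setUC setUAC.
Qed.

End Orthoposets.

Section SkewOrthomodular.
Context {d : Order.disp_t} {P : tbPOrderType d} {compl : P -> P}.
Context (hP : skew_orthomodular compl).
Implicit Types x y : P.

Lemma S_op_le x y : (x <= y)%O -> S_op compl x y = ubound [set y].
Proof.
case: hP => hO skew xy.
rewrite (skew _ _ xy) /S_op !uboundU ubound_lbound2_le //.
rewrite (lbound_disjoint hO) // [[set compl x; _]]setUC.
congr (_ `&` _); apply/setIidl => z _.
by apply/in_ubound1; rewrite le0x.
Qed.

Lemma F_op_le x y : (x <= y)%O -> F_op compl x y = lbound [set x].
Proof.
have [hO _] := hP => xy.
rewrite (F_op_compl hO) S_op_le ?(le_compl2 hO) //.
apply/seteqP; split=> z /= => [/in_ubound1|/in_lbound1] h.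
  by apply/in_lbound1; rewrite -(le_compl2 hO).
by apply/in_ubound1; rewrite (le_compl2 hO).
Qed.

Lemma c_op_le x y : (x <= y)%O -> c_op compl x y = [set \top%O].
Proof.
have [hO _] := hP => xy.
rewrite /c_op uboundU -/(S_op compl x y) S_op_le //.
rewrite [[set compl x; _]]setUC ubound_lbound2_le ?(le_compl2 hO) //.
by rewrite -uboundU (ubound_compl hO).
Qed.

End SkewOrthomodular.

Theorem proposition4p3 (d : Order.disp_t) (P : tbPOrderType d) (compl : P -> P)
  (hP : skew_orthomodular compl) (a b : P) (hab : (a <= b)%O) :
  (S_op compl a b = ubound [set b] /\ F_op compl a b = lbound [set a]) /\
  c_op compl a b = [set \top%O].
Proof. by rewrite S_op_le // F_op_le // c_op_le. Qed.
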